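(* Let $k\ge 3$ be an integer. There exist constants $c=c(k)>0$ and $n_0=n_0(k)$ such that for every $n\ge n_0$: if $G$ is a graph on $n$ vertices with $q(G)\ge q(T_{n,k})$ and $G$ is not isomorphic to $T_{n,k}$, then $G$ contains a copy of the generalized book $B_{k,t}$ for some $t\ge c\,n$.
   Context: All graphs are finite and simple. $q(G)$ denotes the largest eigenvalue of the signless Laplacian $Q(G)=D(G)+A(G)$. $T_{n,k}$ is the complete $k$-partite graph on $n$ vertices with part sizes differing by at most one. The generalized book $B_{k,t}=K_k\vee I_t$ is the graph consisting of a clique $K_k$ and an independent set $I_t$ of size $t$, with every vertex of the clique joined to every vertex of the independent set (equivalently, $t$ copies of $K_{k+1}$ sharing a common $K_k$). *)

(* Defs.v *)
From HB Require Import structures.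
From mathcomp Require Import all_boot all_order all_algebra.
From mathcomp Require Import reals.
Set Implicit Arguments. Unset Strict Implicit. Unset Printing Implicit Defensive.
Import Order.TTheory GRing.Theory Num.Theory.
Local Open Scope ring_scope.

Record graph (n : nat) := Graph {
  adj : rel 'I_n;
  adj_sym : symmetric adj;
  adj_irr : irreflexive adj }.

Definition deg n (G : graph n) (i : 'I_n) : nat := #|[set j | adj G i j]|.

Definition signless_laplacian (R : realType) n (G : graph n) : 'M[R]_n :=
  \matrix_(i, j) ((deg G i)%:R *+ (i == j) + (adj G i j)%:R).

Definition largest_eigenvalue (R : realType) n (A : 'M[R]_n) (q : R) : Prop :=
  eigenvalue A q /\ (forall a : R, eigenvalue A a -> a <= q).

(* Turán graph T_{n,k}: vertex i lies in part (i mod k); parts differ in size by <= 1. *)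
Definition turan_adj n (k : nat) : rel 'I_n := fun i j => (nat_of_ord i %% k)%N != (nat_of_ord j %% k)%N.
Lemma turan_sym n (k : nat) : symmetric (@turan_adj n k).
Proof. by move=> i j; rewrite /turan_adj eq_sym. Qed.
Lemma turan_irr n (k : nat) : irreflexive (@turan_adj n k).
Proof. by move=> i; rewrite /turan_adj eqxx. Qed.
Definition turan_graph n (k : nat) : graph n :=
  Graph (@turan_sym n k) (@turan_irr n k).

(* Generalized book B_{k,t} = K_k v I_t on vertices 'I_(k+t): the first k vertices
   form the clique, the last t form the independent set. *)
Definition book_adj (k t : nat) : rel 'I_(k + t) :=
  fun i j => (i != j) && ((i < k)%N || (j < k)%N).
Lemma book_sym (k t : nat) : symmetric (@book_adj k t).
Proof. by move=> i j; rewrite /book_adj eq_sym orbC. Qed.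
Lemma book_irr (k t : nat) : irreflexive (@book_adj k t).
Proof. by move=> i; rewrite /book_adj eqxx. Qed.
Definition book_graph (k t : nat) : graph (k + t) :=
  Graph (@book_sym k t) (@book_irr k t).

Definition isomorphic n (G H : graph n) : Prop :=
  exists f : 'I_n -> 'I_n, bijective f /\ forall i j, adj G i j = adj H (f i) (f j).

Definition contains_copy m n (H : graph m) (G : graph n) : Prop :=
  exists f : 'I_m -> 'I_n, injective f /\ forall i j, adj H i j -> adj G (f i) (f j).

(* Main.v *)
Require Import Defs.
From HB Require Import structures.
From mathcomp Require Import all_boot all_order all_algebra.
From mathcomp Require Import ring lra.
From mathcomp Require Import reals.
From mathcomp Require boolp classical_sets topology normedtype derive.
Set Implicit Arguments. Unset Strict Implicit. Unset Printing Implicit Defensive.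
Import Order.TTheory GRing.Theory Num.Theory.
Local Open Scope ring_scope.

(* Suppose every k-clique of G has fewer than cn common neighbours, and let x be
   the Perron vector of G, with maximal entry 1, q = q(G) and S = sum of x.

   Greedily pick v_1, v_2, ..., each maximizing x among the common neighbours of
   the previous ones, and let W_i be the set of common neighbours of
   v_1, ..., v_(i-1) not adjacent to v_i. The eigenvalue equation at v_i gives
   (q - n + 2|W_i|) x(W_i) <= |W_i| S. All vertices but the fewer than cn common
   neighbours of v_1, ..., v_k lie in some W_i, so sum_i |W_i|/(q - n + 2|W_i|) is
   almost at least 1; for q = q(T) the maximum of this concave function is 1, at
   balanced sizes. This stability forces S >= (1 - o(1)) n: almost all entries of
   x are close to 1, so almost all degrees are close to (1 - 1/k) n.

   The absence of large books then yields disjoint cores C_1, ..., C_k covering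
   almost all vertices, any two of them almost completely joined. Put each vertex
   in the class of a core in which it has few neighbours, and let K be the
   complete k-partite graph on these classes. An edge of G inside a class has an
   endpoint of low degree, and the edges of K missing at such a vertex outweigh
   the edges gained there, so <Q(G)x,x> <= <Q(K)x,x>, with equality only if G = K.
   Hence q(G) <= q(K). For a complete k-partite graph with class sizes n_i, an
   eigenvalue l > n satisfies sum_i n_i/(l - n + 2 n_i) = 1; concavity in n_i gives
   q(K) <= q(T) with equality only for balanced classes, so G is isomorphic to T. *)

(** * Perron vectors of symmetric nonnegative matrices *)

Section SymmetricForms.
Import boolp classical_sets topology normedtype derive.
Import numFieldNormedType.Exports.
Variables (R : realType) (n : nat).
Implicit Types (A : 'M[R]_n) (x y : 'rV[R]_n).

Definition bform A x y : R := (x *m A *m y^T) 0 0.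
Definition nsq x : R := \sum_i x 0 i ^+ 2.

Lemma bformE A x y : bform A x y = \sum_j \sum_i x 0 i * A i j * y 0 j.
Proof.
by rewrite /bform mxE; apply: eq_bigr => j _; rewrite !mxE mulr_suml.
Qed.

Lemma nsqE x : nsq x = (x *m x^T) 0 0.
Proof. by rewrite /nsq mxE; apply: eq_bigr => i _; rewrite mxE. Qed.

Lemma nsq_ge0 x : 0 <= nsq x.
Proof. by apply: sumr_ge0 => i _; rewrite sqr_ge0. Qed.

Lemma nsq_eq0 x : nsq x = 0 -> x = 0.
Proof.
move=> /eqP; rewrite psumr_eq0; last by move=> i _; rewrite sqr_ge0.
by move=> /allP h; apply/rowP => i; rewrite mxE; apply/eqP;
  rewrite -sqrf_eq0; apply: h; rewrite mem_index_enum.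
Qed.

Lemma nsqD_scale x y (t : R) :
  nsq (x + t *: y) = nsq x + t *+ 2 * (x *m y^T) 0 0 + t ^+ 2 * nsq y.
Proof.
have -> : (x *m y^T) 0 0 = \sum_i x 0 i * y 0 i.
  by rewrite mxE; apply: eq_bigr => i _; rewrite mxE.
rewrite /nsq !mulr_sumr -!big_split /=; apply: eq_bigr => i _.
rewrite !mxE; ring.
Qed.

Lemma bformD_scale A x y (t : R) : A^T = A ->
  bform A (x + t *: y) (x + t *: y) =
  bform A x x + t *+ 2 * bform A x y + t ^+ 2 * bform A y y.
Proof.
move=> sA.
have hs : bform A y x = bform A x y.
  rewrite /bform -[LHS](_ : (y *m A *m x^T)^T 0 0 = _); last by rewrite mxE.
  by rewrite !trmx_mul trmxK sA mulmxA.
rewrite /bform in hs *.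
rewrite !(mulmxDl, mulmxDr, linearD, linearZ, =^~scalemxAl, =^~scalemxAr) /=.
rewrite !mxE in hs *; rewrite hs; ring.
Qed.

(** The form [l * nsq - bform A] is nonnegative and vanishes at [x]. Moving from [x] by [t] times
    the residual [w] turns it into [2 t nsq w + t^2 b], which stays nonnegative for all [t] only if
    [w] is zero. *)
Lemma rayleigh_max_eigen A (l : R) x : A^T = A ->
  (forall y, bform A y y <= l * nsq y) -> bform A x x = l * nsq x ->
  x *m A = l *: x.
Proof.
move=> sA hl hx; set w := l *: x - x *m A.
suff /nsq_eq0 /eqP : nsq w = 0 by rewrite subr_eq0 => /eqP.
have ha : nsq w = l * (x *m w^T) 0 0 - bform A x w.
  by rewrite nsqE {1}/w mulmxBl -scalemxAl /bform !mxE.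
set b := l * nsq w - bform A w w.
have b0 : 0 <= b by rewrite subr_ge0.
have hq t : 0 <= t *+ 2 * nsq w + t ^+ 2 * b.
  have := hl (x + t *: w); rewrite nsqD_scale bformD_scale // hx ha /b; nra.
(* With [u = nsq w / (b + 1)] the quadratic takes the value [- u^2 (b + 2)] here; dividing by
   [b + 1] rather than [b] covers [b = 0]. *)
have h := hq (- (nsq w / (b + 1))).
have b1 : b + 1 != 0 by rewrite gt_eqF // ltr_wpDl.
set u := nsq w / (b + 1) in h.
have hu : nsq w = u * (b + 1) by rewrite /u divfK.
have : u ^+ 2 <= 0 by move: h; rewrite hu; nra.
move=> u2; have /eqP : u ^+ 2 = 0 by apply/eqP; rewrite eq_le u2 sqr_ge0.
by rewrite sqrf_eq0 hu => /eqP ->; rewrite mul0r.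
Qed.

Lemma bform_continuous A : continuous (fun x : 'rV[R]_n => bform A x x).
Proof.
have -> : (fun x : 'rV[R]_n => bform A x x) =
   (fun x => \sum_j \sum_i x 0 i * A i j * x 0 j).
  by apply/funext => x; rewrite bformE.
move=> x.
apply: (@cvg_big _ _ _ _ _ (@add_continuous R^o) _ (nbhs x)) => j _.
apply: (@cvg_big _ _ _ _ _ (@add_continuous R^o) _ (nbhs x)) => i _.
apply: cvgM; last exact: coord_continuous.
by apply: cvgM; [exact: coord_continuous | exact: cvg_cst].
Qed.

Lemma nsq_continuous : continuous (nsq : 'rV[R]_n -> R).
Proof.
have -> : (nsq : 'rV[R]_n -> R) = (fun x => bform 1%:M x x).
  by apply/funext => x; rewrite nsqE /bform mulmx1.
exact: bform_continuous.
Qed.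

(** Compactness gives a maximizer on the nonnegative part of the unit sphere. Since [A] is
    nonnegative, taking absolute values of the entries does not decrease the form, so this maximum
    bounds the form everywhere. *)
Lemma perron A : (0 < n)%N -> A^T = A -> (forall i j, 0 <= A i j) ->
  exists l x, [/\ x != 0, forall i, 0 <= x 0 i, x *m A = l *: x &
    forall y, bform A y y <= l * nsq y].
Proof.
move=> n0 sA A0.
pose B := [set v : 'rV[R]_n | forall i, `[0, 1]%classic (v ord0 i)]%classic.
pose S := [set v : 'rV[R]_n | nsq v = 1]%classic.
have cS : closed S.
  apply: (@closed_comp _ _ nsq [set x | x = 1]%classic); last exact: closed_eq.
  by move=> x _; exact: nsq_continuous.
have cB : compact (B `&` S)%classic.
  apply: compact_closedI cS; apply: (@rV_compact R n (fun=> `[0, 1]%classic)).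
  by move=> _; exact: segment_compact.
have hBS (v : 'rV[R]_n) : (forall i, 0 <= v 0 i) -> nsq v = 1 -> (B `&` S)%classic v.
  move=> v0 v1; split=> // i /=; rewrite in_itv /= v0 /= -(@expr_le1 _ 2) //.
  by rewrite -v1 /nsq (bigD1 i) //= lerDl sumr_ge0 // => j _; rewrite sqr_ge0.
have [||x /set_mem[xB xS] hmax] := @EVT_max_rV R n (fun x => bform A x x) _ _ cB.
- exists (delta_mx 0 (Ordinal n0)); apply: hBS => [i|].
    by rewrite mxE ler0n.
  rewrite /nsq (bigD1 (Ordinal n0)) //= mxE !eqxx expr1n big1 ?addr0 //.
  by move=> i hi; rewrite mxE (negbTE hi) andbF expr0n.
- by apply: continuous_subspaceT; exact: bform_continuous.
have hl y : bform A y y <= bform A x x * nsq y.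
  have [y0|y0] := eqVneq (nsq y) 0.
    rewrite (nsq_eq0 y0) /bform mul0mx mul0mx mxE /nsq big1 ?mulr0 // => i _.
    by rewrite mxE expr0n.
  have yp : 0 < nsq y by rewrite lt_def y0 nsq_ge0.
  pose s := Num.sqrt (nsq y).
  have sp : 0 < s by rewrite sqrtr_gt0.
  have s2 : s ^+ 2 = nsq y by rewrite sqr_sqrtr // ltW.
  pose z : 'rV[R]_n := \row_i (`|y 0 i| / s).
  have hz : (B `&` S)%classic z.
    apply: hBS => [i|]; first by rewrite mxE divr_ge0 // ltW.
    rewrite /nsq -(divff y0) {2}/nsq mulr_suml; apply: eq_bigr => i _.
    by rewrite mxE expr_div_n s2 real_normK // num_real.
  have := hmax z (mem_set hz).
  rewrite -ler_pdivrMr //; apply: le_trans; rewrite !bformE mulr_suml.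
  apply: ler_sum => j _; rewrite mulr_suml; apply: ler_sum => i _.
  rewrite !mxE -s2.
  have -> : `|y 0 i| / s * A i j * (`|y 0 j| / s) =
     `|y 0 i| * A i j * `|y 0 j| / s ^+ 2 by field; rewrite gt_eqF.
  rewrite ler_pM2r ?invr_gt0 ?exprn_gt0 //.
  by rewrite -{2}(ger0_norm (A0 i j)) -!normrM ler_norm.
exists (bform A x x), x; split=> //.
- apply/eqP => x0; have := xS; rewrite /S /= x0 /nsq big1 => [/eqP|i _].
    by rewrite eq_sym oner_eq0.
  by rewrite mxE expr0n.
- by move=> i; have := xB i; rewrite /= in_itv /= => /andP[].
- by apply: rayleigh_max_eigen => //; rewrite xS mulr1.
Qed.

Lemma largest_eigenvalue_perron A q : (0 < n)%N -> A^T = A ->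
  (forall i j, 0 <= A i j) -> largest_eigenvalue A q ->
  (exists x, [/\ x != 0, forall i, 0 <= x 0 i & x *m A = q *: x]) /\
  forall y, bform A y y <= q * nsq y.
Proof.
move=> n0 sA A0 [/eigenvalueP[v hv v0] hmax].
have [l [x [x0 xp hx hl]]] := perron n0 sA A0.
have lq : l <= q by apply: hmax; apply/eigenvalueP; exists x.
suff ql : q = l by rewrite ql; split=> //; exists x.
apply/eqP; rewrite eq_le lq andbT.
have vp : 0 < nsq v.
  by rewrite lt_def nsq_ge0 andbT; apply: contraNneq v0 => /nsq_eq0 ->.
by have := hl v; rewrite /bform hv -scalemxAl mxE -nsqE ler_pM2r.
Qed.

End SymmetricForms.

(** * The signless Laplacian as a quadratic form *)

Section SignlessLaplacian.
Variables (R : realType) (n : nat).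
Implicit Types (G : graph n) (y : 'I_n -> R) (u v : 'I_n).

Definition nbr G u : {set 'I_n} := [set v | adj G u v].
(** Ordered pairs count each edge twice, so for a graph this is twice the signless Laplacian form. A
    bare relation as argument lets a graph and a partition be compared alike. *)
Definition energy (E : rel 'I_n) y : R :=
  \sum_u \sum_v (E u v)%:R * (y u + y v) ^+ 2.
Definition eigenfun G (q : R) y : Prop :=
  forall u, (q - (deg G u)%:R) * y u = \sum_(v in nbr G u) y v.

Lemma sum_nbr G u y : \sum_(v in nbr G u) y v = \sum_v (adj G u v)%:R * y v.
Proof.
rewrite big_mkcond /=; apply: eq_bigr => v _; rewrite inE.
by case: ifP => _; rewrite (mul1r, mul0r).
Qed.

Lemma degE G u : (deg G u)%:R = \sum_v (adj G u v)%:R :> R.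
Proof.
rewrite /deg -sum1_card natr_sum big_mkcond /=; apply: eq_bigr => v _.
by rewrite inE; case: ifP.
Qed.

Lemma signless_sym G : (signless_laplacian R G)^T = signless_laplacian R G.
Proof.
apply/matrixP => i j; rewrite !mxE eq_sym adj_sym.
by case: eqP => [->|_].
Qed.

Lemma signless_ge0 G i j : 0 <= signless_laplacian R G i j.
Proof. by rewrite mxE addr_ge0 // mulrn_wge0. Qed.

Lemma signless_row G (x : 'rV[R]_n) u :
  (x *m signless_laplacian R G) 0 u =
  (deg G u)%:R * x 0 u + \sum_(v in nbr G u) x 0 v.
Proof.
rewrite mxE sum_nbr.
under eq_bigr => v _ do rewrite mxE mulrDr adj_sym [X in _ + X]mulrC.
rewrite big_split /=; congr (_ + _).
rewrite (bigD1 u) //= eqxx mulr1n mulrC big1 ?addr0 // => v /negbTE ->.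
by rewrite mulr0n mulr0.
Qed.

Lemma eigenfun_signless G q (x : 'rV[R]_n) :
  x *m signless_laplacian R G = q *: x <-> eigenfun G q (x 0).
Proof.
split=> [h u | h]; last first.
  by apply/rowP => u; rewrite signless_row mxE -h; ring.
by have := congr1 (fun M : 'rV[R]_n => M 0 u) h; rewrite /= signless_row mxE mulrBl => <-; ring.
Qed.

Lemma energy_split G y : energy (adj G) y =
  2 * \sum_u y u * ((deg G u)%:R * y u + \sum_(v in nbr G u) y v).
Proof.
pose a u v : R := (adj G u v)%:R.
have h u : y u * ((deg G u)%:R * y u + \sum_(v in nbr G u) y v) =
    \sum_v a u v * (y u ^+ 2 + y u * y v).
  rewrite sum_nbr degE mulr_suml -big_split mulr_sumr /=.
  by apply: eq_bigr => v _; rewrite /a; ring.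
rewrite mulr2n mulrDl mul1r; under eq_bigr => u _ do rewrite h.
rewrite {2}exchange_big /= -big_split /=; apply: eq_bigr => u _.
rewrite -big_split /=; apply: eq_bigr => v _.
rewrite /a adj_sym; ring.
Qed.

Lemma energy_eigenfun G q y : eigenfun G q y ->
  energy (adj G) y = 2 * (q * \sum_u y u ^+ 2).
Proof.
move=> h; rewrite energy_split; congr (_ * _); rewrite mulr_sumr.
by apply: eq_bigr => u _; rewrite -h; ring.
Qed.

Lemma bform_signless G (x : 'rV[R]_n) :
  2 * bform (signless_laplacian R G) x x = energy (adj G) (x 0).
Proof.
rewrite energy_split /bform mxE; congr (_ * _); apply: eq_bigr => u _.
by rewrite signless_row mxE mulrC.
Qed.

Lemma energy_le G q y : (0 < n)%N ->
  largest_eigenvalue (signless_laplacian R G) q ->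
  energy (adj G) y <= 2 * (q * \sum_u y u ^+ 2).
Proof.
move=> n0 hq.
have [_ h] := largest_eigenvalue_perron n0 (signless_sym G) (@signless_ge0 G) hq.
have := h (\row_u y u); rewrite -(@ler_pM2l _ 2) // bform_signless.
have -> : energy (adj G) ((\row_u y u) 0) = energy (adj G) y.
  by apply: eq_bigr => u _; apply: eq_bigr => v _; rewrite !mxE.
suff -> : nsq (\row_u y u) = \sum_u y u ^+ 2 by [].
by apply: eq_bigr => u _; rewrite mxE.
Qed.

Lemma perron_eigenfun G q : (0 < n)%N ->
  largest_eigenvalue (signless_laplacian R G) q ->
  exists y u0, [/\ eigenfun G q y, forall u, 0 <= y u <= 1 & y u0 = 1].
Proof.
move=> n0 hq.
have [[x [x0 xp hx]] _] :=
  largest_eigenvalue_perron n0 (signless_sym G) (@signless_ge0 G) hq.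
pose u0 := [arg max_(u > Ordinal n0) x 0 u]%O.
have hmax u : x 0 u <= x 0 u0.
  by rewrite /u0; case: arg_maxP => // i _; apply.
have p0 : 0 < x 0 u0.
  rewrite lt_def xp andbT; apply: contraNneq x0 => h0.
  by apply/eqP/rowP => u; rewrite mxE; apply/eqP; rewrite eq_le xp -h0 hmax.
exists (fun u => x 0 u / x 0 u0), u0; split.
- move=> u; have /eigenfun_signless h := hx.
  by rewrite mulrA h mulr_suml.
- by move=> u; rewrite divr_ge0 //= ler_pdivrMr // mul1r.
- by rewrite divff // gt_eqF.
Qed.

Lemma largest_eigenvalue_exists G : (0 < n)%N ->
  exists q, largest_eigenvalue (signless_laplacian R G) q.
Proof.
move=> n0.
have [l [x [x0 _ hx hl]]] := perron n0 (signless_sym G) (@signless_ge0 G).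
exists l; split; first by apply/eigenvalueP; exists x.
move=> a /eigenvalueP[v hv v0].
have vp : 0 < nsq v.
  by rewrite lt_def nsq_ge0 andbT; apply: contraNneq v0 => /nsq_eq0 ->.
by have := hl v; rewrite /bform hv -scalemxAl mxE -nsqE ler_pM2r.
Qed.

Lemma largest_eigenvalue_eigenfun G q :
  largest_eigenvalue (signless_laplacian R G) q ->
  exists2 y, eigenfun G q y & exists u, y u != 0.
Proof.
move=> [/eigenvalueP[v hv v0] _]; exists (v 0); first exact/eigenfun_signless.
by apply/rV0Pn.
Qed.

End SignlessLaplacian.

(** * Cliques, books and the greedy weight estimate *)

Section Cliques.
Variables (R : realType) (n : nat) (G : graph n).
Implicit Types (L U : {set 'I_n}) (u v : 'I_n).

Definition clique L := {in L &, forall u v, u != v -> adj G u v}.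
Definition cnbr L : {set 'I_n} := [set v | [forall u in L, adj G u v]].
(** Common neighbours of a [k]-clique serve directly as pages, because a copy of a book need not be
    induced. A real [m] allows multiples of [n]. *)
Definition bookfree k (m : R) :=
  forall L, clique L -> #|L| = k -> #|cnbr L|%:R < m.

Lemma cnbrP L v : reflect {in L, forall u, adj G u v} (v \in cnbr L).
Proof. by rewrite inE; apply: (iffP forall_inP). Qed.

Lemma clique0 : clique set0.
Proof. by move=> u v; rewrite inE. Qed.

Lemma cnbr0 : cnbr set0 = setT.
Proof. by apply/setP => v; rewrite !inE; apply/forall_inP => u; rewrite inE. Qed.

Lemma cnbrU1 L v : cnbr (v |: L) = cnbr L :&: nbr G v.
Proof.
apply/setP => w; apply/cnbrP/setIP => [h|[/cnbrP h hv] u].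
  split; last by rewrite inE; apply: h; rewrite setU11.
  by apply/cnbrP => u uL; apply: h; rewrite setU1r.
by rewrite inE in hv *; rewrite !inE => /orP[/eqP -> //|]; apply: h.
Qed.

Lemma cnbr1 v : cnbr [set v] = nbr G v.
Proof. by rewrite -[[set v]]setU0 cnbrU1 cnbr0 setTI. Qed.

Lemma cnbr_notin L v : v \in cnbr L -> v \notin L.
Proof. by move=> /cnbrP h; apply/negP => /h; rewrite adj_irr. Qed.

Lemma cliqueU1 L v : clique L -> v \in cnbr L -> clique (v |: L).
Proof.
move=> cL /cnbrP hv a b; rewrite !inE => /orP[/eqP ->|aL] /orP[/eqP ->|bL] ab.
- by rewrite eqxx in ab.
- by rewrite adj_sym hv.
- by rewrite hv.
- exact: cL.
Qed.

Lemma clique1 v : clique [set v].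
Proof. by move=> a b; rewrite !inE => /eqP -> /eqP ->; rewrite eqxx. Qed.

Lemma book_of_clique L : clique L ->
  contains_copy (book_graph #|L| #|cnbr L|) G.
Proof.
move=> cL.
pose f (i : 'I_(#|L| + #|cnbr L|)) : 'I_n :=
  match split i with inl a => enum_val a | inr b => enum_val b end.
exists f; split.
  move=> i j; rewrite /f -{2}[i]splitK -{2}[j]splitK.
  case: (split i) => a; case: (split j) => b /= h.
  - by rewrite (enum_val_inj h).
  - by have := enum_valP b; rewrite -h => /cnbr_notin; rewrite enum_valP.
  - by have := enum_valP a; rewrite h => /cnbr_notin; rewrite enum_valP.
  - by rewrite (enum_val_inj h).
move=> i j; rewrite /= /book_adj /f.
case: (splitP i) => a ea; case: (splitP j) => b eb /andP[ij hij].
- apply: cL; rewrite ?enum_valP //; apply: contra_neq ij => /enum_val_inj ab.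
  exact/ord_inj/(etrans ea)/(etrans (congr1 _ ab))/esym.
- by have /cnbrP h := enum_valP b; apply: h; rewrite enum_valP.
- by rewrite adj_sym; have /cnbrP h := enum_valP a; apply: h; rewrite enum_valP.
- by [].
Qed.

Lemma bookfree_of_no_book k (m : R) :
  ~ (exists t, m <= t%:R /\ contains_copy (book_graph k t) G) -> bookfree k m.
Proof.
move=> h L cL Lk; rewrite ltNge; apply/negP => hm; apply: h.
by exists #|cnbr L|; split => //; rewrite -Lk; exact: book_of_clique.
Qed.

End Cliques.

Section GreedyWeights.
Variables (R : realType) (n : nat) (G : graph n) (q : R) (y : 'I_n -> R).
Variables (k : nat) (h e m : R).
Hypotheses (n_gt0 : (0 < n)%N) (hy : eigenfun G q y).
Hypotheses (y01 : forall u, 0 <= y u <= 1).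
Hypotheses (h_gt0 : 0 < h) (e_ge0 : 0 <= e) (m_ge0 : 0 <= m) (hm : bookfree G k m).
Hypothesis (hq : n%:R + h * n%:R - e <= q).

Implicit Types (U V W L : {set 'I_n}).

Let N : R := n%:R.
Let S := \sum_u y u.
Let X (U : {set 'I_n}) := \sum_(u in U) y u.

Lemma setweight_ge0 U : 0 <= X U.
Proof. by apply: sumr_ge0 => u _; case/andP: (y01 u). Qed.

Lemma setweight_le_card U : X U <= #|U|%:R.
Proof.
rewrite -sum1_card natr_sum; apply: ler_sum => u _.
by case/andP: (y01 u).
Qed.

Lemma setweight_split U V : X U = X (U :&: V) + X (U :\: V).
Proof. exact: big_setID. Qed.

Lemma setweight_total U : S = X U + X (~: U).
Proof.
rewrite -setTD -[U in X U](setTI U) -setweight_split.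
by apply: eq_bigl => u; rewrite inE.
Qed.

Lemma setweight_sub U V : U \subset V -> X U <= X V.
Proof.
by move=> /setIidPr UV; rewrite (setweight_split V U) UV lerDl setweight_ge0.
Qed.

(* The right-hand side comes from the tangent of the concave function
   w |-> w / (h N + 2 w) at w = (1 - h) N / 2. *)
Lemma greedy_step v (W : {set 'I_n}) : [disjoint W & nbr G v] ->
  (forall u, u \in W -> y u <= y v) ->
  X W <= (S + e) * ((1 - h) ^+ 2 / 2 + h / N * #|W|%:R).
Proof.
move=> dW hW; set w : R := #|W|%:R.
have Np : 0 < N by rewrite ltr0n.
have w0 : 0 <= w by rewrite ler0n.
have yv : 0 <= y v <= 1 by [].
have XW : X W <= w * y v.
  rewrite /w -sum1_card natr_sum mulr_suml; apply: ler_sum => u uW.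
  by rewrite mul1r hW.
have dN : (deg G v)%:R + w <= N.
  rewrite /deg -/(nbr G v) -natrD ler_nat addnC -cardsUI.
  by rewrite (disjoint_setI0 dW) cards0 addn0 -[leqRHS]card_ord max_card.
have row : (q - (deg G v)%:R) * y v + X W <= S.
  rewrite hy (setweight_total (nbr G v)) lerD2l setweight_sub //.
  by rewrite subsets_disjoint setCK.
(* The eigenvalue equation at [v] and [deg v <= N - w] bound [(h N - e + w) y v] by [S - X W].
   Multiplying by [w], using [X W <= w y v], and absorbing [e] through [y v <= 1] gives the
   claim. *)
have h1 : (h * N + 2 * w) * X W <= w * (S + e).
  have a1 : (h * N - e + w) * y v <= S - X W.
    rewrite lerBrDr; apply: le_trans row; rewrite lerD2r ler_wpM2r //.
      by case/andP: yv.
    by have := hq; rewrite -/N; lra.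
  have a2 : w * ((h * N - e + w) * y v) <= w * (S - X W) by rewrite ler_wpM2l.
  have a3 : (h * N + w) * X W <= (h * N + w) * (w * y v).
    by rewrite ler_wpM2l // addr_ge0 // mulr_ge0 // ltW.
  have a4 : e * w * y v <= e * w by rewrite ler_piMr ?mulr_ge0 //; case/andP: yv.
  by move: a2 a3 a4; nra.
have D0 : 0 < h * N + 2 * w by rewrite ltr_wpDr ?mulr_gt0 // mulr_ge0.
have Se : 0 <= S + e.
  by rewrite addr_ge0 // (setweight_total set0) addr_ge0 // setweight_ge0.
rewrite -(ler_pM2l D0) (le_trans h1) //.
have -> : (h * N + 2 * w) * ((S + e) * ((1 - h) ^+ 2 / 2 + h / N * w)) =
   w * (S + e) + (S + e) * (h / (2 * N) * (N * (1 - h) - 2 * w) ^+ 2).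
  by field; rewrite gt_eqF.
rewrite lerDl mulr_ge0 // mulr_ge0 ?sqr_ge0 // divr_ge0 ?mulr_ge0 // ltW //.
Qed.

(** Induction on the number [j] of vertices still to pick. Non-neighbours of the next vertex are
    handled by [greedy_step], the rest by induction; the bound is affine in the size, so the sizes
    add up. Once [k] vertices are picked, [bookfree] leaves at most [m]. *)
Lemma greedy_weight j L : clique G L -> (#|L| + j)%N = k ->
  X (cnbr G L) <=
  (S + e) * (j%:R * ((1 - h) ^+ 2 / 2) + h / N * #|cnbr G L|%:R) + m.
Proof.
have Np : 0 < N by rewrite ltr0n.
have Se : 0 <= S + e.
  by rewrite addr_ge0 // (setweight_total set0) addr_ge0 // setweight_ge0.
elim: j L => [|j IH] L cL Lk.
  rewrite addn0 in Lk; rewrite mul0r add0r.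
  have := le_trans (setweight_le_card (cnbr G L)) (ltW (hm cL Lk)).
  move/le_trans; apply; rewrite lerDr mulr_ge0 // mulr_ge0 // divr_ge0 // ltW //.
have a0 : 0 <= (1 - h) ^+ 2 / 2 by rewrite divr_ge0 ?sqr_ge0.
have b0 : 0 <= h / N by rewrite divr_ge0 // ltW.
have [U0|[v0 v0U]] := set_0Vmem (cnbr G L).
  by rewrite U0 /X big_set0 addr_ge0 // mulr_ge0 // cards0 mulr0 addr0 mulr_ge0.
pose v := [arg max_(u > v0 in cnbr G L) y u]%O.
have [vU hv] : v \in cnbr G L /\ forall u, u \in cnbr G L -> y u <= y v.
  by rewrite /v; case: arg_maxP => // i iU hi; split=> // u; exact: hi.
have := IH (v |: L) (cliqueU1 cL vU).
rewrite cardsU1 (cnbr_notin vU) -Lk addSnnS => /(_ (erefl _)).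
rewrite cnbrU1 => h2.
have h1 : X (cnbr G L :\: nbr G v) <=
    (S + e) * ((1 - h) ^+ 2 / 2 + h / N * #|cnbr G L :\: nbr G v|%:R).
  apply: (@greedy_step v); first by rewrite disjoint_sym disjoints_subset setCD subsetUr.
  by move=> u /setDP[uU _]; exact: hv.
rewrite (setweight_split _ (nbr G v)) -(cardsID (nbr G v) (cnbr G L)) natrD.
apply: le_trans (lerD h2 h1) _; rewrite le_eqVlt; apply/orP; left.
by apply/eqP; rewrite -addn1 natrD; ring.
Qed.

End GreedyWeights.

(* Put t = th - 2p, x = d - p and T = p + (2p - 1)x. Inserting the last upper bound
   on s into the preceding one leaves t(1 - T) + 2(2p - 1)x^2 <= 2g^2: the terms
   linear in x cancel, so x = O(g), and the same bound then gives s >= 1 - O(g). *)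
Lemma weight_numeric (R : realFieldType) (p th d s z g : R) :
  2/3 <= p <= 1 -> 0 <= d <= 1 -> s <= 1 -> 0 < g <= 1/18 -> 0 <= z <= g ^+ 2 ->
  2 * p - z <= th ->
  th - d <= (s + z) * (2 * p * (1 - p) + (2 * p - 1) * d) + g ^+ 2 ->
  s <= 1 + th - 2 * d ->
  1 - 18 * g <= s.
Proof.
move=> /andP[p1 p2] /andP[d0 d1] s1 /andP[g0 g1] /andP[z0 z1] hth H1 H2.
set T := 2 * p * (1 - p) + (2 * p - 1) * d in H1.
pose c := g ^+ 2; rewrite -/c in z1 H1.
have T1 : T <= 1.
  have -> : T = 1 - 2 * (1 - p) ^+ 2 - (2 * p - 1) * (1 - d) by rewrite /T; ring.
  have := sqr_ge0 (1 - p); have : 0 <= (2 * p - 1) * (1 - d) by apply: mulr_ge0; lra.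
  lra.
have T0 : 0 <= T by apply: addr_ge0; apply: mulr_ge0; lra.
have zT : z * T <= c by apply: le_trans (ler_piMr _ _) z1.
have H1' : th - d <= s * T + 2 * c by move: H1; rewrite mulrDl; lra.
pose x := d - p; pose t := th - 2 * p.
have sT : s * T <= (1 + t - 2 * x) * T.
  by rewrite ler_wpM2r // /x /t; lra.
have ht : t * (1 - T) >= - c.
  have : 0 <= (t + z) * (1 - T) by apply: mulr_ge0; rewrite /t; lra.
  have : z * (1 - T) <= z * 1 by rewrite ler_wpM2l //; lra.
  by rewrite mulrDl mulr1; lra.
have eT : T = p + (2 * p - 1) * x by rewrite /T /x; ring.
have key : t * (1 - T) + 2 * (2 * p - 1) * x ^+ 2 <= 2 * c.
  have -> : t * (1 - T) + 2 * (2 * p - 1) * x ^+ 2 =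
     th - d - (1 + t - 2 * x) * T by rewrite eT /t /x; ring.
  lra.
have x2 : x ^+ 2 <= (3 * g) ^+ 2.
  have : 2 * (1/3) * x ^+ 2 <= 2 * (2 * p - 1) * x ^+ 2.
    by rewrite ler_wpM2r ?sqr_ge0 //; lra.
  rewrite exprMn -/c; have : 0 <= c by apply: sqr_ge0.
  lra.
have [xl xu] : - (3 * g) <= x /\ x <= 3 * g.
  by apply/andP; rewrite -ler_norml -(@ler_pXn2r _ 2) ?nnegrE ?mulr_ge0 ?normr_ge0
    ?real_normK ?num_real // ltW.
have cg : c <= g / 18 by rewrite /c expr2 ler_wpM2l //; lra.
(* Since [T] is at least 1/2, the bound [9 g] on [(1 - s) T] yields [18 g] for [1 - s]. *)
have T2 : 1/2 <= T.
  rewrite eT; have : (2 * p - 1) * - (3 * g) <= (2 * p - 1) * x.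
    by rewrite ler_wpM2l //; lra.
  have : (2 * p - 1) * (3 * g) <= 1 * (3 * g) by rewrite ler_wpM2r //; lra.
  lra.
have H3 : (1 - s) * T <= 9 * g.
  have : (2 * p - 1) * x <= (2 * p - 1) * (3 * g) by rewrite ler_wpM2l //; lra.
  have : (2 * p - 1) * (3 * g) <= 1 * (3 * g) by rewrite ler_wpM2r //; lra.
  have e1 : (1 - s) * T = p + (2 * p - 1) * x - s * T by rewrite eT; ring.
  have ed : d = x + p by rewrite /x; ring.
  rewrite e1; lra.
have : (1 - s) * (1/2) <= (1 - s) * T by rewrite ler_wpM2l //; lra.
lra.
Qed.

(** * Total weight of the Perron vector *)

Section TotalWeight.
Variables (R : realType) (n : nat) (G : graph n) (q : R) (y : 'I_n -> R).
Variables (k : nat) (u0 : 'I_n) (e m g : R).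
Hypotheses (n_gt0 : (0 < n)%N) (k_ge3 : (3 <= k)%N) (hy : eigenfun G q y).
Hypotheses (y01 : forall u, 0 <= y u <= 1) (yu0 : y u0 = 1).
Hypotheses (hg : 0 < g <= 1/18).
Hypotheses (he : 0 <= e <= g ^+ 2 * n%:R) (hm : 0 <= m <= g ^+ 2 * n%:R).
Hypothesis (Gk : bookfree G k m).
Hypothesis (hq : n%:R + (1 - 2 / k%:R) * n%:R - e <= q).

(** Starting the greedy choice at [u0], where the entry is 1, makes the weight of the first
    neighbourhood exactly [q - deg u0]. The greedy bound on it, together with
    [S <= (n - d) + (q - d)], becomes [weight_numeric] after division by [n]. *)
Lemma total_weight : (1 - 18 * g) * n%:R <= \sum_u y u.
Proof.
set N : R := n%:R; set S := \sum_u y u.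
have Np : 0 < N by rewrite ltr0n.
have k3 : (3 : R) <= k%:R by rewrite ler_nat.
have kV : 0 < (k%:R : R)^-1 <= 1/3.
  by rewrite invr_gt0 mul1r lef_pV2 ?posrE //; lra.
case/andP: kV => kV0 kV1.
have [e0 e1] := andP he; have [m0 m1] := andP hm.
have h0 : 0 < 1 - 2 / k%:R :> R by lra.
have := greedy_weight n_gt0 hy y01 h0 e0 m0 Gk hq (j := k.-1) (@clique1 n G u0).
rewrite cards1 add1n prednK ?(ltnW (ltnW k_ge3)) // => /(_ (erefl _)).
rewrite cnbr1 -/S -/N -hy yu0 mulr1 -/(deg G u0).
set d : R := (deg G u0)%:R => H1.
have dN : d <= N by rewrite ler_nat -[leqRHS]card_ord max_card.
have H2 : S <= N - d + (q - d).
  have -> : S = \sum_(u in nbr G u0) y u + \sum_(u in ~: nbr G u0) y u.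
    exact: (setweight_total y).
  rewrite -hy yu0 mulr1 -/d addrC lerD2r.
  apply: le_trans (setweight_le_card y01 _) _.
  have := cardsC (nbr G u0); rewrite card_ord => /(congr1 (fun a => a%:R : R)).
  by rewrite natrD -/d -/N => <-; rewrite addrAC subrr add0r.
have H3 : S <= N.
  rewrite /N -[n in n%:R]card_ord -sum1_card natr_sum.
  by apply: ler_sum => u _; case/andP: (y01 u).
pose p := 1 - (k%:R : R)^-1.
have ek : ((k.-1)%:R : R) = k%:R - 1.
  by rewrite -[k in RHS](@prednK k) ?(ltnW (ltnW k_ge3)) // -addn1 natrD addrK.
have kn0 : (k%:R : R) != 0 by rewrite gt_eqF //; lra.
rewrite -ler_pdivlMr //.
apply: (@weight_numeric _ p (q / N) (d / N) (S / N) (e / N)) => //.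
- by rewrite /p; lra.
- by rewrite divr_ge0 ?ler0n //= ler_pdivrMr ?mul1r.
- by rewrite ler_pdivrMr ?mul1r.
- by rewrite divr_ge0 // ler_pdivrMr.
- rewrite ler_pdivlMr // mulrBl divfK ?gt_eqF //; apply: le_trans hq.
  by rewrite /p -/N; lra.
- rewrite -mulrBl ler_pdivrMr //; apply: le_trans H1 _.
  rewrite [leRHS]mulrDl; apply: lerD => //.
  rewrite le_eqVlt; apply/orP; left; apply/eqP; rewrite ek /p.
  by field; rewrite kn0 gt_eqF.
- rewrite ler_pdivrMr //; apply: le_trans H2 _.
  rewrite le_eqVlt; apply/orP; left; apply/eqP.
  by field; rewrite gt_eqF.
Qed.

End TotalWeight.

(** * Cores *)

Section RealCard.
Variables (R : realType) (n : nat).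
Implicit Types (A B D : {set 'I_n}).

Lemma cardr_le A B : A \subset B -> #|A|%:R <= #|B|%:R :> R.
Proof. by move=> AB; rewrite ler_nat subset_leq_card. Qed.

Lemma cardr_ID A B : #|A|%:R = #|A :&: B|%:R + #|A :\: B|%:R :> R.
Proof. by rewrite -natrD cardsID. Qed.

Lemma cardr_C A : #|A|%:R + #|~: A|%:R = n%:R :> R.
Proof. by rewrite -natrD cardsC card_ord. Qed.

Lemma cardr_disjoint A B D : [disjoint A & B] -> A \subset D -> B \subset D ->
  #|A|%:R + #|B|%:R <= #|D|%:R :> R.
Proof.
move=> /disjoint_setI0 AB AD BD; rewrite -natrD ler_nat -cardsUI AB cards0 addn0.
by rewrite subset_leq_card // subUset AD.
Qed.

Lemma cardr_gt0 A : 0 < #|A|%:R :> R -> exists u, u \in A.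
Proof. by rewrite ltr0n => /card_gt0P. Qed.

Lemma cardr_sum A : #|A|%:R = \sum_u (u \in A)%:R :> R.
Proof.
by rewrite -sum1_card natr_sum big_mkcond /=; apply: eq_bigr => u _; case: ifP.
Qed.
End RealCard.

Section Cores.
Variables (R : realType) (n : nat) (G : graph n) (k : nat).
Variables (H : {set 'I_n}) (m a M : R).
Local Notation N := n%:R.
Local Notation K := k%:R.
Hypotheses (k_ge3 : (3 <= k)%N) (NM : N = K * M :> R) (m_bd : 0 < m <= a).
Hypotheses (Ma : 1000 * (K ^+ 2 * a) <= M) (Gk : bookfree G k m).
Hypotheses (H_co : #|~: H|%:R <= a).
Hypothesis (H_deg : forall u, u \in H -> N - M - 2 * a <= (deg G u)%:R).

Lemma core_params : [/\ 0 < a, 3 <= K :> R, 3 * a <= K * a, 3 * (K * a) <= K ^+ 2 * a &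
  1000 * (K ^+ 2 * a) <= M].
Proof.
have a0 : 0 < a by case/andP: m_bd => m0 /(lt_le_trans m0).
have k3 : 3 <= K :> R by rewrite ler_nat.
split=> //; first by rewrite ler_pM2r.
by rewrite expr2 -mulrA ler_pM2r // mulr_gt0 //; lra.
Qed.

(** Each vertex of [H] misses at most [M + 2 a] vertices, so after fewer than [k] picks more than
    [a] common neighbours remain, and one of them lies in [H]. *)
Lemma clique_in_H j : (j <= k)%N -> exists L : {set 'I_n}, [/\ L \subset H, clique G L,
  #|L| = j & N - j%:R * (M + 2 * a) <= #|cnbr G L|%:R].
Proof.
have [a0 k3 ka kka Ma'] := core_params.
elim: j => [|j IH] jk.
  exists set0; split; rewrite ?sub0set ?cards0 //; first exact: clique0.
  by rewrite cnbr0 cardsT card_ord mul0r subr0.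
have [L [LH cL Lj hL]] := IH (ltnW jk).
have jK : j%:R + 1 <= K :> R by rewrite natr1 ler_nat.
have [v] : exists v, v \in cnbr G L :&: H.
  apply: (@cardr_gt0 R).
  have := cardr_ID R (cnbr G L) H.
  have : #|cnbr G L :\: H|%:R <= #|~: H|%:R :> R by apply: cardr_le; rewrite setDE subsetIr.
  have : (j%:R + 1) * (M + 2 * a) <= K * (M + 2 * a) by rewrite ler_wpM2r //; lra.
  rewrite mulrDl mul1r [K * _]mulrDr -NM; have := H_co; lra.
rewrite inE => /andP[vL vH]; exists (v |: L); split.
- by rewrite subUset sub1set vH.
- exact: cliqueU1.
- by rewrite cardsU1 (cnbr_notin vL) Lj.
- rewrite cnbrU1 -addn1 natrD mulrDl mul1r.
  have := cardr_ID R (cnbr G L) (nbr G v); have := H_deg vH; rewrite /deg -/(nbr G v).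
  have : #|cnbr G L :\: nbr G v|%:R <= #|~: nbr G v|%:R :> R.
    by apply: cardr_le; rewrite setDE subsetIr.
  have := cardr_C R (nbr G v); lra.
Qed.

Definition is_core (C : 'I_k -> {set 'I_n}) :=
  [/\ forall i, C i \subset H, forall i j, i != j -> [disjoint C i & C j],
      forall i, M - 5 * (K * a) <= #|C i|%:R <= M + 2 * a,
      N - 3 * (K * a) <= \sum_i #|C i|%:R &
      forall i j u, u \in C i -> i != j -> #|C j :\: nbr G u|%:R <= 6 * (K * a)].

(** A vertex [w] with few neighbours in [C i] spends nearly all of its at most [M + x]
    non-neighbours there, so few are left for [C j]. *)
Lemma few_missing (C : 'I_k -> {set 'I_n}) (i j : 'I_k) w x z : i != j ->
  [disjoint C i & C j] -> M - 5 * (K * a) <= #|C i|%:R ->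
  N - M - x <= (deg G w)%:R -> #|C i :&: nbr G w|%:R <= z ->
  #|C j :\: nbr G w|%:R <= x + z + 5 * (K * a).
Proof.
move=> ij dij Ci dw iz.
have : #|C i :\: nbr G w|%:R + #|C j :\: nbr G w|%:R <= #|~: nbr G w|%:R :> R.
  apply: cardr_disjoint; [|by rewrite setDE subsetIr|by rewrite setDE subsetIr].
  by apply: disjointW dij; rewrite subsetDl.
have := cardr_ID R (C i) (nbr G w); have := cardr_C R (nbr G w).
by move: dw; rewrite /deg -/(nbr G w); lra.
Qed.

Lemma core_exists : exists C, is_core C.
Proof.
have [a0 k3 ka kka Ma'] := core_params; have [m0 ma] := andP m_bd.
have [L [LH cL Lk _]] := clique_in_H (leqnn k).
pose v (i : 'I_k) : 'I_n := enum_val (cast_ord (esym Lk) i).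
have vL i : v i \in L by exact: enum_valP.
have v_inj : injective v by move=> i j /enum_val_inj /cast_ord_inj.
have Lv u : u \in L -> exists i, u = v i.
  move=> uL; exists (cast_ord Lk (enum_rank_in uL u)).
  by rewrite /v cast_ordK enum_rankK_in.
(* [C i] holds the vertices of [H] whose only non-neighbour in the clique is [v i]; it contains
   [v i] itself. *)
pose C i : {set 'I_n} := [set u in H | [forall j, adj G (v j) u == (j != i)]].
have CP i u : u \in C i -> u \in H /\ forall j, adj G (v j) u = (j != i).
  by rewrite inE => /andP[-> /forallP h]; split=> // j; apply/eqP.
have Cd i j : i != j -> [disjoint C i & C j].
  move=> ij; rewrite -setI_eq0; apply/eqP/setP => u; rewrite !inE.
  apply/negP => /andP[/andP[_ /forallP hi] /andP[_ /forallP hj]].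
  by have := eqP (hi i); rewrite (eqP (hj i)) eqxx ij.
(* Exchanging [v i] for [u] gives another [k]-clique, and the neighbours of [u] in [C i] are common
   neighbours of it. *)
have Cin i u : u \in C i -> #|C i :&: nbr G u|%:R < m :> R.
  move=> uC; have [uH hu] := CP _ _ uC.
  have cL' : clique G (L :\ v i).
    by move=> x z /setD1P[_ xL] /setD1P[_ zL]; exact: cL.
  have uL' : u \in cnbr G (L :\ v i).
    apply/cnbrP => x /setD1P[xi /Lv[j ej]]; rewrite ej hu.
    by apply: contraNneq xi => ji; rewrite ej ji.
  have sz : #|u |: L :\ v i| = k.
    by rewrite cardsU1 (cnbr_notin uL') -Lk (cardsD1 (v i) L) vL.
  apply: le_lt_trans (Gk (cliqueU1 cL' uL') sz).
  apply: cardr_le; apply/subsetP => x /setIP[xC xu]; rewrite cnbrU1 inE xu andbT.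
  have [_ hx] := CP _ _ xC; apply/cnbrP => z /setD1P[zi /Lv[j ej]]; rewrite ej hx.
  by apply: contraNneq zi => ji; rewrite ej ji.
have Cup i : #|C i|%:R <= M + 2 * a :> R.
  have : #|C i|%:R <= #|~: nbr G (v i)|%:R :> R.
    apply: cardr_le; apply/subsetP => u /CP[_ hu].
    by rewrite !inE hu eqxx.
  have := H_deg (subsetP LH _ (vL i)); have := cardr_C R (nbr G (v i)).
  by rewrite /deg -/(nbr G (v i)); lra.
have Ctot : N - 3 * (K * a) <= \sum_i #|C i|%:R.
  (* Double count the pairs (i, u) with v i adjacent to u. *)
  have pt u : \sum_i (adj G (v i) u)%:R <= K - 2 + \sum_i (u \in C i)%:R
      + 2 * (u \in cnbr G L)%:R + (u \in ~: H)%:R :> R.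
    pose J := [set i | ~~ adj G (v i) u].
    have s0 : 0 <= \sum_i (u \in C i)%:R :> R by apply: sumr_ge0.
    have -> : \sum_i (adj G (v i) u)%:R = K - #|J|%:R :> R.
      have -> : K = #|J|%:R + #|~: J|%:R :> R by rewrite -natrD cardsC card_ord.
      rewrite addrAC subrr add0r -sum1_card natr_sum [RHS]big_mkcond /=.
      by apply: eq_bigr => i _; rewrite !inE negbK; case: ifP.
    have b1 : 0 <= (u \in cnbr G L)%:R :> R by [].
    have b2 : 0 <= (u \in ~: H)%:R :> R by [].
    (* Cases on the number of clique vertices not adjacent to [u]: none makes [u] a common neighbour
       of [L], one puts [u] into a class or outside [H], and two or more leave at most [K - 2]
       adjacencies. *)
    case e : #|J| => [|[|l]].
    - have -> : u \in cnbr G L.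
        apply/cnbrP => x /Lv[i ->]; have : i \notin J by rewrite (cards0_eq e) inE.
        by rewrite inE negbK.
      by rewrite mulr1; lra.
    - have /cards1P[i Ji] : #|J| == 1%N by apply/eqP.
      have [uH|uH] := boolP (u \in H); last by rewrite in_setC uH /=; lra.
      rewrite (bigD1 i) //=; have -> : u \in C i.
        rewrite inE uH; apply/forallP => j.
        have : (j \in J) = (j == i) by rewrite Ji inE.
        by rewrite inE => <-; rewrite negbK.
      have : 0 <= \sum_(j < k | j != i) (u \in C j)%:R :> R by apply: sumr_ge0.
      rewrite /=; lra.
    - have : (2 : R) <= l.+2%:R by rewrite ler_nat.
      lra.
  have := ler_sum (index_enum 'I_n) (fun u (_ : true) => pt u).
  have eC : \sum_(u < n) \sum_i (u \in C i)%:R = \sum_i #|C i|%:R :> R.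
    by rewrite exchange_big /=; apply: eq_bigr => i _; rewrite -cardr_sum.
  have eN : (K - 2) *+ n = K * N - 2 * N :> R by rewrite -mulr_natl; ring.
  rewrite exchange_big /= 3!big_split /= eC sumr_const card_ord eN.
  rewrite -mulr_sumr -!cardr_sum.
  have h1 : K * (N - M - 2 * a) <= \sum_i \sum_u (adj G (v i) u)%:R.
    have -> : K * (N - M - 2 * a) = \sum_(i < k) (N - M - 2 * a).
      by rewrite sumr_const card_ord mulr_natl.
    apply: ler_sum => i _; rewrite -degE; apply: H_deg.
    exact: (subsetP LH).
  have := Gk cL Lk.
  have : K * (N - M - 2 * a) = K * N - N - 2 * (K * a) by rewrite !mulrBr -NM; ring.
  have := H_co; lra.
have Clow i : M - 5 * (K * a) <= #|C i|%:R.
  move: Ctot; rewrite (bigD1 i) //=.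
  have : \sum_(j < k | j != i) #|C j|%:R <= (K - 1) * (M + 2 * a).
    have -> : (K - 1) * (M + 2 * a) = \sum_(j < k | j != i) (M + 2 * a).
      rewrite sumr_const -[RHS]mulr_natl; congr (_ * _).
      have := cardC1 i; rewrite card_ord => /(congr1 (fun b => b.+1%:R : R)).
      rewrite prednK ?(ltnW (ltnW k_ge3)) // -addn1 natrD => <-.
      by rewrite addrK; congr (_%:R); apply: eq_card.
    by apply: ler_sum => j _.
  have -> : (K - 1) * (M + 2 * a) = N - M + 2 * (K * a) - 2 * a by rewrite NM; ring.
  lra.
exists C; split=> //.
- by move=> i; apply/subsetP => u /CP[].
- by move=> i; rewrite Clow Cup.
- move=> i j u uC ij; have [uH _] := CP _ _ uC.
  have := few_missing ij (Cd _ _ ij) (Clow i) (H_deg uH) (ltW (Cin _ _ uC)).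
  lra.
Qed.

(** Extend the clique by one vertex from each class of [J] but the last. Each pick costs every
    remaining class at most [6 K a] common neighbours, so at least [m] pages survive in the last
    class. The total [k + 1] counts the class kept for the pages. *)
Lemma core_book C L (J : {set 'I_k}) : is_core C -> clique G L ->
  (#|L| + #|J| = k.+1)%N -> (0 < #|J|)%N ->
  (forall j, j \in J -> #|J|%:R * (6 * (K * a)) + m <= #|C j :&: cnbr G L|%:R) ->
  False.
Proof.
move=> [_ _ _ _ Cmiss]; have [a0 k3 ka kka _] := core_params; have [m0 ma] := andP m_bd.
move eqc: #|J| => c; elim: c J L eqc => // c IH J L Jc cL LJ _ hJ.
have [j jJ] : exists j, j \in J by apply/card_gt0P; rewrite Jc.
have cp : 0 <= c%:R :> R by [].
have hj := hJ j jJ; rewrite -natr1 in hj.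
have cKa : 0 <= c%:R * (6 * (K * a)) by apply: mulr_ge0 => //; lra.
have J1 : #|J :\ j| = c by have := cardsD1 j J; rewrite Jc jJ; case.
case: (posnP c) => [c0|c_gt0].
  have Lk : #|L| = k by move: LJ; rewrite c0 addn1; case.
  have := Gk cL Lk; have : #|C j :&: cnbr G L|%:R <= #|cnbr G L|%:R :> R.
    by apply: cardr_le; rewrite subsetIr.
  move: hj; rewrite mulrDl mul1r; lra.
have [v] : exists v, v \in C j :&: cnbr G L.
  by apply: (@cardr_gt0 R); move: hj; rewrite mulrDl mul1r; lra.
rewrite inE => /andP[vC vL].
apply: (IH (J :\ j) (v |: L)) => //.
- exact: cliqueU1.
- by rewrite cardsU1 (cnbr_notin vL) add1n addSnnS.
move=> i /setD1P[ij iJ]; have := hJ i iJ.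
have := Cmiss j i v vC; rewrite eq_sym => /(_ ij).
have := cardr_ID R (C i :&: cnbr G L) (nbr G v); rewrite cnbrU1 setIA.
have : #|(C i :&: cnbr G L) :\: nbr G v|%:R <= #|C i :\: nbr G v|%:R :> R.
  by apply: cardr_le; rewrite setSD // subsetIl.
by rewrite -natr1 mulrDl mul1r; lra.
Qed.

(** Otherwise [core_book] grows a book from [w] through all [k] classes, losing at most [6 K^2 a]
    vertices per class. *)
Lemma core_sparse C w : is_core C ->
  exists i, #|C i :&: nbr G w|%:R <= 7 * (K ^+ 2 * a).
Proof.
move=> hC; apply/existsP; rewrite -[X in is_true X]negbK negb_exists; apply/negP => /forallP h.
have [a0 k3 ka kka _] := core_params; have [m0 ma] := andP m_bd.
apply: (core_book (L := [set w]) (J := setT) hC).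
- exact: clique1.
- by rewrite cards1 cardsT card_ord.
- by rewrite cardsT card_ord (ltnW (ltnW k_ge3)).
move=> j _; have := h j; rewrite -ltNge cnbr1 cardsT card_ord.
have -> : K * (6 * (K * a)) = 6 * (K ^+ 2 * a) by ring.
lra.
Qed.

(** If both ends had high degree, [few_missing] would join each of them to almost all of every other
    class, and [core_book] would extend the edge through the [k - 1] classes other than [i]. *)
Lemma core_inner C i w z : is_core C -> adj G w z ->
  #|C i :&: nbr G w|%:R <= 7 * (K ^+ 2 * a) ->
  #|C i :&: nbr G z|%:R <= 7 * (K ^+ 2 * a) ->
  N - M - 300 * (K ^+ 2 * a) <= (deg G w)%:R ->
  (deg G z)%:R < N - M - 300 * (K ^+ 2 * a).
Proof.
move=> hC wz iw iz dw; rewrite ltNge; apply/negP => dz.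
have [a0 k3 ka kka Ma'] := core_params; have [m0 ma] := andP m_bd.
have [_ Cd Cs _ _] := hC.
have kp : (0 < k)%N := ltnW (ltnW k_ge3).
have Ji : #|[set~ i]| = k.-1 by rewrite cardsC1 card_ord.
apply: (core_book (L := w |: [set z]) (J := [set~ i]) hC).
- by apply: cliqueU1; [exact: clique1 | rewrite cnbr1 inE adj_sym].
- rewrite Ji cardsU1 cards1 inE; case: eqP wz => [->|_ _]; first by rewrite adj_irr.
  by rewrite addn1 addSnnS prednK.
- by rewrite Ji; move: k_ge3; case: (k) => [|[]].
move=> j; rewrite !inE Ji eq_sym => ij.
have kk : k.-1%:R * (6 * (K * a)) <= 6 * (K ^+ 2 * a).
  have -> : 6 * (K ^+ 2 * a) = K * (6 * (K * a)) by ring.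
  by rewrite ler_wpM2r ?ler_nat ?leq_pred //; lra.
have /andP[Ci1 Ci2] := Cs i; have /andP[Cj1 Cj2] := Cs j.
have := few_missing ij (Cd _ _ ij) Ci1 dw iw.
have := few_missing ij (Cd _ _ ij) Ci1 dz iz.
rewrite cnbrU1 cnbr1.
have := cardr_ID R (C j) (nbr G z); have := cardr_ID R (C j :&: nbr G z) (nbr G w).
rewrite setIA.
have : #|(C j :&: nbr G z) :\: nbr G w|%:R <= #|C j :\: nbr G w|%:R :> R.
  by apply: cardr_le; rewrite setSD // subsetIl.
lra.
Qed.

End Cores.

(** * Comparison with a complete multipartite graph *)

Section Comparison.
Variables (R : realType) (n : nat) (G : graph n) (k : nat).
Variables (H : {set 'I_n}) (m a M q : R) (y : 'I_n -> R).
Variables (C : 'I_k -> {set 'I_n}) (P : 'I_n -> 'I_k).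
Local Notation N := n%:R.
Local Notation K := k%:R.
Hypotheses (k_ge3 : (3 <= k)%N) (NM : N = K * M :> R) (m_bd : 0 < m <= a).
Hypotheses (Ma : 1000 * (K ^+ 2 * a) <= M) (Gk : bookfree G k m).
Hypotheses (hC : is_core G H a M C).
Hypothesis (hP : forall u, #|C (P u) :&: nbr G u|%:R <= 7 * (K ^+ 2 * a)).
Hypotheses (hy : eigenfun G q y) (y01 : forall u, 0 <= y u <= 1).
Hypotheses (yH : forall u, u \in H -> 1/2 <= y u).
Hypothesis (yS : \sum_u (1 - y u) <= a).

Let core_par := core_params k_ge3 m_bd Ma.
(** By [core_part] below, [D] is the union of the cores. The low-degree set [B] meets every edge
    inside a class, by [core_inner]. *)
Let D := [set u | u \in C (P u)].
Let B := [set u | (deg G u)%:R < N - M - 300 * (K ^+ 2 * a)].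

(** A vertex of [C j] misses little of any other core, yet has few neighbours in [C (P u)], which
    has nearly [M] vertices. *)
Lemma core_part u j : u \in C j -> P u = j.
Proof.
move=> uC; apply/eqP; apply/negPn/negP => ij.
have [a0 k3 ka kka Ma'] := core_par; have [_ _ Cs _ Cm] := hC.
have /andP[Cs1 _] := Cs (P u); rewrite eq_sym in ij.
have := Cm _ _ _ uC ij; have := hP u; have := cardr_ID R (C (P u)) (nbr G u).
lra.
Qed.

Lemma core_cover : N - 3 * (K * a) <= #|D|%:R.
Proof.
have [_ _ _ Ct _] := hC; apply: le_trans Ct _.
rewrite cardr_sum; under eq_bigr => i _ do rewrite cardr_sum.
rewrite exchange_big /=; apply: ler_sum => u _.
rewrite (bigD1 (P u)) //= big1 ?addr0 ?inE // => j.
by case: (boolP (u \in C j)) => // /core_part ->; rewrite eqxx.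
Qed.

Lemma gain_le u : #|[set v in nbr G u | P u == P v]|%:R <= 8 * (K ^+ 2 * a).
Proof.
have [a0 k3 ka kka _] := core_par.
have := cardr_ID R [set v in nbr G u | P u == P v] D.
have : #|[set v in nbr G u | P u == P v] :\: D|%:R <= #|~: D|%:R :> R.
  by apply: cardr_le; rewrite setDE subsetIr.
have : #|[set v in nbr G u | P u == P v] :&: D|%:R <= #|C (P u) :&: nbr G u|%:R :> R.
  apply: cardr_le; apply/subsetP => v; rewrite !inE => /andP[/andP[-> /eqP ->]].
  by rewrite andbT.
have := hP u; have := cardr_C R D; have := core_cover; lra.
Qed.

(** A vertex of [B] misses more than [M + 300 K^2 a] vertices, of which its own core accounts for at
    most [M + 2 a] and the complement of [D] for at most [3 K a]. *)
Lemma loss_ge u : u \in B ->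
  298 * (K ^+ 2 * a) <= #|[set v in D | (P u != P v) && ~~ adj G u v]|%:R.
Proof.
have [a0 k3 ka kka _] := core_par; have [_ _ Cs _ _] := hC.
rewrite inE /deg -/(nbr G u) => dB; have /andP[_ Cu] := Cs (P u).
have := cardr_ID R D (C (P u) :|: nbr G u).
have : #|D :&: (C (P u) :|: nbr G u)|%:R <= #|C (P u)|%:R + #|nbr G u|%:R :> R.
  rewrite -natrD ler_nat; apply: leq_trans (leq_card_setU _ _).
  by apply: subset_leq_card; rewrite subsetIr.
have -> : D :\: (C (P u) :|: nbr G u) = [set v in D | (P u != P v) && ~~ adj G u v].
  apply/setP => v; rewrite !inE negb_or; have [vD|] := boolP (v \in C (P v)).
    rewrite andbT /=; congr (~~ _ && _).
    by apply/idP/eqP => [/core_part -> //|->].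
  by rewrite andbF.
have := core_cover; lra.
Qed.

(** [s] marks edges of [G] inside a class; [t] marks missing cross pairs whose second end lies in a
    core, where [y] is at least 1/2. *)
Let s u v : R := (adj G u v && (P u == P v))%:R.
Let t u v : R := (v \in [set v in D | (P u != P v) && ~~ adj G u v])%:R.
Let part_rel : rel 'I_n := fun u v => P u != P v.

(** An edge inside a class weighs at most 4 and has an end in [B]; a pair marked by [t] weighs at
    least [(1/2)^2]. Losses at [u] outside [B] are simply dropped. *)
Lemma energy_pointwise u v :
  ((adj G u v)%:R - (part_rel u v)%:R) * (y u + y v) ^+ 2 <=
  (u \in B)%:R * (4 * s u v - 1/4 * t u v) + (v \in B)%:R * (4 * s u v).
Proof.
have [a0 k3 ka kka _] := core_par.
have /andP[u0 u1] := y01 u; have /andP[v0 v1] := y01 v.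
have y4 : (y u + y v) ^+ 2 <= 4 by have := sqr_ge0 (y u + y v); nra.
have y0 := sqr_ge0 (y u + y v).
rewrite /s /t /part_rel in_set; case: (boolP (adj G u v)) => uv;
  case: (eqVneq (P u) (P v)) => Puv; rewrite /= ?andbF ?andbT /= ?subrr ?mul0r.
- have : (u \in B) || (v \in B).
    rewrite -implyNb; apply/implyP; rewrite !inE -leNgt.
    have iv := hP v; rewrite -Puv in iv.
    by move=> du; exact: (core_inner k_ge3 m_bd Ma Gk hC uv (hP u) iv du).
  by case: (u \in B); case: (v \in B) => //= _; lra.
- by rewrite !mulr0 subrr !mulr0 addr0.
- by rewrite !mulr0 subrr !mulr0 addr0.
rewrite !mulr0 addr0 !sub0r mulN1r mulrN lerN2.
have [vD|_] := boolP (v \in D); last by rewrite !mulr0.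
have : 1/2 <= y v.
  by apply: yH; have [CH _ _ _ _] := hC; apply: (subsetP (CH (P v))); rewrite inE in vD.
case: (u \in B); rewrite /= ?mul1r ?mul0r //; nra.
Qed.

(** Symmetry moves the gains charged to [v] over to [u]. Each vertex of [B] then gains at most
    [8 * 8 = 64] and loses at least [298 / 4 = 74.5], in units of [K^2 a]. *)
Lemma energy_gap :
  energy (adj G) y + 10 * (K ^+ 2 * a) * #|B|%:R <= energy part_rel y.
Proof.
have [a0 k3 ka kka _] := core_par.
rewrite -lerBrDl -lerN2 opprB.
have -> : energy (adj G) y - energy part_rel y = \sum_u \sum_v
    ((adj G u v)%:R - (part_rel u v)%:R) * (y u + y v) ^+ 2.
  rewrite /energy -sumrB; apply: eq_bigr => u _; rewrite -sumrB.
  by apply: eq_bigr => v _; rewrite mulrBl.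
apply: (@le_trans _ _ (\sum_u \sum_v
    ((u \in B)%:R * (4 * s u v - 1/4 * t u v) + (v \in B)%:R * (4 * s u v)))).
  by apply: ler_sum => u _; apply: ler_sum => v _; exact: energy_pointwise.
have -> : \sum_u \sum_v ((u \in B)%:R * (4 * s u v - 1/4 * t u v) +
     (v \in B)%:R * (4 * s u v)) =
   \sum_u (u \in B)%:R * (8 * (\sum_v s u v) - 1/4 * \sum_v t u v).
  under eq_bigr => u _ do rewrite big_split /=.
  rewrite big_split /= [X in _ + X]exchange_big -big_split /=; apply: eq_bigr => u _.
  rewrite mulrBr !mulr_sumr -sumrB -big_split; apply: eq_bigr => v _ /=.
  by rewrite /s (adj_sym G v u) (eq_sym (P v)); ring.
rewrite -mulNr cardr_sum mulr_sumr; apply: ler_sum => u _.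
have [uB|_] := boolP (u \in B); last by rewrite mul0r mulr0.
rewrite mulr1 /=.
have es : \sum_v s u v = #|[set v in nbr G u | P u == P v]|%:R.
  by rewrite cardr_sum; apply: eq_bigr => v _; rewrite !inE.
rewrite es /t -cardr_sum; have := gain_le u; have := loss_ge uB; lra.
Qed.

(** A zero entry forces zeros on all neighbours; each adds 1 to the total deficit, which is at most
    [a], far below the degree. Positivity makes every edge count in the equality case. *)
Lemma low_degree_free : B = set0 -> forall u, 0 < y u.
Proof.
move=> B0 u; have [a0 k3 ka kka Ma'] := core_par.
have : u \notin B by rewrite B0 inE.
rewrite inE -leNgt => du; have /andP[u0 _] := y01 u.
rewrite lt_def u0 andbT; apply/eqP => yu.
have := hy u; rewrite yu mulr0 => /esym s0.
have : \sum_(v in nbr G u) (1 - y v) <= a.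
  apply: le_trans yS; rewrite [leLHS]big_mkcond /=; apply: ler_sum => v _.
  by case: ifP => // _; have /andP[_] := y01 v; lra.
rewrite sumrB s0 subr0 sumr_const -/(deg G u) => da.
have : 3 * M <= N by rewrite NM ler_wpM2r //; lra.
lra.
Qed.

(** Equality empties [B], hence [G] has no edge inside a class. The energy difference is then a sum
    of nonnegative terms with positive weights, so no cross pair is missing. *)
Lemma energy_compare : energy (adj G) y <= energy part_rel y /\
  (energy part_rel y <= energy (adj G) y -> forall u v, adj G u v = (P u != P v)).
Proof.
have [a0 k3 ka kka Ma'] := core_par; have gap := energy_gap.
have b0 : 0 < 10 * (K ^+ 2 * a) by lra.
have Bg : 0 <= 10 * (K ^+ 2 * a) * #|B|%:R by rewrite mulr_ge0 // ltW.
split; first by lra.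
move=> ge; have B0 : B = set0.
  apply: cards0_eq; apply/eqP; rewrite -(eqr_nat R) eq_le ler0n andbT.
  by rewrite -(pmulr_rle0 _ b0); lra.
have yp := low_degree_free B0.
have sub u v : adj G u v -> P u != P v.
  move=> uv; have := energy_pointwise u v; rewrite uv /part_rel.
  case: eqP => // _; rewrite !B0 !inE !mul0r addr0 subr0 mul1r.
  by rewrite leNgt exprn_gt0 // addr_gt0.
have term u v : 0 <= ((part_rel u v)%:R - (adj G u v)%:R) * (y u + y v) ^+ 2.
  apply: mulr_ge0 (sqr_ge0 _); rewrite subr_ge0 ler_nat /part_rel.
  by case: (adj G u v) (sub u v) => // ->.
have z : \sum_u \sum_v ((part_rel u v)%:R - (adj G u v)%:R) * (y u + y v) ^+ 2 = 0.
  apply/eqP; rewrite eq_le; apply/andP; split; last first.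
    by apply: sumr_ge0 => u _; apply: sumr_ge0 => v _; exact: term.
  rewrite -(subr_le0 (energy _ _)) in ge; apply: le_trans ge.
  rewrite le_eqVlt /energy -sumrB; apply/orP; left; apply/eqP; apply: eq_bigr => u _.
  by rewrite -sumrB; apply: eq_bigr => v _; rewrite mulrBl.
move=> u v; apply/idP/idP => [/sub //|Puv].
have /eqP := z; rewrite psumr_eq0; last by move=> i _; apply: sumr_ge0 => j _; exact: term.
move=> /allP /(_ u (mem_index_enum _)) /=; rewrite psumr_eq0 //.
move=> /allP /(_ v (mem_index_enum _)) /=.
rewrite mulf_eq0 sqrf_eq0 (gt_eqF (addr_gt0 (yp u) (yp v))) orbF /part_rel Puv.
by case: (adj G u v) => //; rewrite subr0 oner_eq0.
Qed.

End Comparison.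

(** * Complete multipartite graphs *)

Section Multipartite.
Variables (n k : nat) (P : 'I_n -> 'I_k).

Definition part (i : 'I_k) : {set 'I_n} := [set u | P u == i].

Lemma sum_card_part : (\sum_i #|part i| = n)%N.
Proof.
rewrite -[RHS]card_ord -sum1_card (partition_big P predT) //=.
by apply: eq_bigr => i _; rewrite -sum1_card; apply: eq_bigl => u; rewrite inE.
Qed.

Variables (G : graph n).
Hypothesis hG : forall u v, adj G u v = (P u != P v).

Lemma multipartite_nbr u : nbr G u = ~: part (P u).
Proof. by apply/setP => v; rewrite !inE hG eq_sym. Qed.

(** Summing the eigenvalue equation over part [i] of size [n_i] gives [(l - n + 2 n_i) X i = n_i Z].
    Summing over [i] and cancelling [Z] finishes; [Z = 0] would force [z = 0]. *)
Lemma multipartite_eigen (R : realType) (l : R) (z : 'I_n -> R) :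
  n%:R < l -> eigenfun G l z -> (exists u, z u != 0) ->
  \sum_i #|part i|%:R / (l - n%:R + 2 * #|part i|%:R) = 1.
Proof.
move=> nl hz [u0 zu0]; pose Z := \sum_u z u; pose X i := \sum_(u in part i) z u.
have D0 i : 0 < l - n%:R + 2 * #|part i|%:R.
  by rewrite ltr_pwDl ?subr_gt0 // mulr_ge0.
have row u : (l - n%:R + #|part (P u)|%:R) * z u = Z - X (P u).
  have := hz u; rewrite /deg -/(nbr G u) multipartite_nbr.
  have := cardr_C R (part (P u)); rewrite /Z (setweight_total z (part (P u))).
  by rewrite -/(X (P u)) => <- <-; ring.
have XZ i : (l - n%:R + 2 * #|part i|%:R) * X i = #|part i|%:R * Z.
  have : (l - n%:R + #|part i|%:R) * X i = #|part i|%:R * (Z - X i).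
    transitivity (\sum_(u in part i) (Z - X i)); last by rewrite sumr_const mulr_natl.
    rewrite {1}/X mulr_sumr; apply: eq_bigr => u.
    by rewrite inE => /eqP <-; exact: row.
  move=> h; have -> : (l - n%:R + 2 * #|part i|%:R) * X i =
    (l - n%:R + #|part i|%:R) * X i + #|part i|%:R * X i by ring.
  by rewrite h; ring.
have Xi i : X i = #|part i|%:R / (l - n%:R + 2 * #|part i|%:R) * Z.
  by rewrite mulrAC -XZ mulrC mulKf // gt_eqF.
have ZX : Z = \sum_i X i.
  rewrite /Z (partition_big P predT) //=; apply: eq_bigr => i _.
  by apply: eq_bigl => u; rewrite inE.
have Z0 : Z != 0.
  apply: contraNneq zu0 => Z0; have := row u0; rewrite Xi Z0 mulr0 subr0.
  move/eqP; rewrite mulf_eq0 => /orP[|//].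
  by rewrite gt_eqF // ltr_pwDl ?subr_gt0.
apply: (mulIf Z0); rewrite mul1r mulr_suml {2}ZX.
by apply: eq_bigr => i _; rewrite -Xi.
Qed.

Lemma balanced_iso : (0 < k)%N ->
  (forall i, #|part i| = (n %/ k)%N \/ #|part i| = (n %/ k).+1%N) ->
  isomorphic G (turan_graph n k).
Proof.
move=> k0 bal; pose S := [set i | #|part i| == (n %/ k).+1%N].
have Sr : #|S| = (n %% k)%N.
  apply/eqP; rewrite -(eqn_add2l (n %/ k * k)%N) -divn_eq -[X in _ == X]sum_card_part.
  rewrite -sum1_card [X in (_ + X)%N]big_mkcond /= mulnC -[k in (k * _)%N]card_ord.
  rewrite -sum_nat_const -big_split /=; apply/eqP/eq_bigr => i _.
  rewrite inE; case: (bal i) => ->; last by rewrite eqxx addn1.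
  by rewrite ltn_eqF // addn0.
(* The larger parts receive the residues below [n mod k], which are exactly the longer residue
   classes of the Turán graph. *)
pose pi i := if i \in S then index i (enum S) else (n %% k + index i (enum (~: S)))%N.
have idS i : i \in S -> (index i (enum S) < n %% k)%N.
  by move=> iS; rewrite -Sr cardE index_mem mem_enum.
have pi_lt i : (pi i < k)%N.
  rewrite /pi; case: ifP => iS; first exact: ltn_trans (idS i iS) (ltn_pmod _ k0).
  rewrite -[X in (_ < X)%N](card_ord k) -(cardsC S) Sr ltn_add2l cardE index_mem.
  by rewrite mem_enum inE iS.
have pi_inj : injective pi.
  move=> i j; rewrite /pi; case: ifPn => iS; case: ifPn => jS.
  - by move/(congr1 (nth i (enum S))); rewrite !nth_index ?mem_enum.
  - by move=> e; have := idS i iS; rewrite e ltnNge leq_addr.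
  - by move=> e; have := idS j jS; rewrite -e ltnNge leq_addr.
  - move/addnI => /(congr1 (nth i (enum (~: S)))).
    by rewrite !nth_index ?mem_enum ?in_setC.
pose rk u := index u (enum (part (P u))).
have rk_lt u : (rk u < #|part (P u)|)%N.
  by rewrite cardE index_mem mem_enum inE.
(* The rank within the part selects the block of length [k]. Rank [n / k] occurs only in larger
   parts, whose residue is below [n mod k], so the image stays below [n]. *)
have f_lt u : (rk u * k + pi (P u) < n)%N.
  rewrite [X in (_ < X)%N](divn_eq n k); have := rk_lt u; have := pi_lt (P u).
  rewrite /pi inE; case: (bal (P u)) => e; rewrite e.
    rewrite ltn_eqF // => pk rkm; apply: (@leq_trans ((rk u).+1 * k)).
      by rewrite mulSn addnC ltn_add2r.
    apply: leq_trans (leq_addr _ _); by rewrite leq_mul2r rkm orbT.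
  rewrite eqxx => _; rewrite ltnS => rkm.
  by rewrite -addnS leq_add ?leq_mul2r ?rkm ?orbT // idS // inE e.
pose f u : 'I_n := Ordinal (f_lt u).
have fmod u : (f u %% k)%N = pi (P u) by rewrite /= modnMDl modn_small.
exists f; split; last first.
  move=> u v; rewrite hG /= /turan_adj !fmod.
  by rewrite (inj_eq pi_inj).
apply: injF_bij => u v e.
have Puv : P u = P v by apply: pi_inj; rewrite -!fmod e.
have : rk u = rk v.
  have := congr1 (fun w : 'I_n => (w %/ k)%N) e.
  by rewrite /= !divnMDl // !divn_small // !addn0.
rewrite /rk Puv => /(congr1 (nth u (enum (part (P v))))).
by rewrite !nth_index ?mem_enum ?inE ?Puv.
Qed.

End Multipartite.

(** * Concavity in the part sizes *)

Section Balanced.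
Variables (R : realType) (k : nat).

(* The right-hand side is the chord through m and m + 1 of c |-> c / (b + 2 c). *)
Lemma chord_le (b : R) (c m : nat) : 0 < b ->
  c%:R / (b + 2 * c%:R) <= m%:R / (b + 2 * m%:R) +
    (c%:R - m%:R) * (b / ((b + 2 * m%:R) * (b + 2 * m%:R + 2))) ?= iff
    (c == m) || (c == m.+1).
Proof.
move=> b0; set x : R := c%:R; set w : R := m%:R.
have x0 : 0 <= x by []. have w0 : 0 <= w by [].
have D1 : 0 < b + 2 * x by lra.
have D2 : 0 < b + 2 * w by lra.
have D3 : 0 < b + 2 * w + 2 by lra.
set rhs := (X in _ <= X ?= iff _).
have e : rhs - x / (b + 2 * x) = 2 * b * ((x - w) * (x - w - 1)) /
    ((b + 2 * x) * (b + 2 * w) * (b + 2 * w + 2)).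
  by rewrite /rhs; field; rewrite !gt_eqF.
have F0 : 0 < 2 * b / ((b + 2 * x) * (b + 2 * w) * (b + 2 * w + 2)).
  by rewrite divr_gt0 ?mulr_gt0.
have eS : w + 1 = m.+1%:R by rewrite natr1.
split.
  rewrite -subr_ge0 e mulrAC mulr_ge0 ?(ltW F0) //.
  case: (leqP c m) => cm.
    have : x <= w by rewrite ler_nat.
    by move=> ?; rewrite mulr_le0 //; lra.
  have : w + 1 <= x by rewrite eS ler_nat.
  by move=> ?; rewrite mulr_ge0 //; lra.
rewrite eq_sym -subr_eq0 e mulrAC mulf_eq0 (gt_eqF F0) /= mulf_eq0 !subr_eq0.
by rewrite eqr_nat subr_eq addrC eS eqr_nat.
Qed.

(** With [L] the chord, [1 = sum f b' (s i) <= sum f b (s i) <= sum L (s i) = sum L (t i) = 1],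
    where the sums of [L] agree because [L] is affine. All inequalities are therefore termwise
    equalities. *)
Lemma balanced_of_sums (b b' : R) (s t : 'I_k -> nat) (m : nat) :
  0 < b <= b' -> (\sum_i s i = \sum_i t i)%N ->
  (forall i, t i = m \/ t i = m.+1) ->
  \sum_i (s i)%:R / (b' + 2 * (s i)%:R) = 1 ->
  \sum_i (t i)%:R / (b + 2 * (t i)%:R) = 1 ->
  b' = b /\ forall i, s i = m \/ s i = m.+1.
Proof.
move=> /andP[b0 bb] st tm hs ht.
pose f (d : R) (c : nat) : R := c%:R / (d + 2 * c%:R).
pose L (c : nat) : R := m%:R / (b + 2 * m%:R) +
    (c%:R - m%:R) * (b / ((b + 2 * m%:R) * (b + 2 * m%:R + 2))).
have fb c : f b' c <= f b c.
  rewrite /f ler_wpM2l // lef_pV2 ?posrE ?lerD2r //; rewrite ltr_pwDl ?mulr_ge0 //.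
  exact: lt_le_trans bb.
have fL c : f b c <= L c by apply: (chord_le c m b0).1.
have sL : \sum_i L (s i) = \sum_i L (t i).
  rewrite /L !big_split /= -!mulr_suml; congr (_ + _ * _).
  by rewrite !sumrB -!natr_sum st.
have tL : \sum_i L (t i) = 1.
  rewrite -ht; apply: eq_bigr => i _; apply/esym/eqP.
  by rewrite (chord_le (t i) m b0).2; case: (tm i) => ->; rewrite eqxx ?orbT.
have z : \sum_i (L (s i) - f b' (s i)) = 0 by rewrite sumrB sL tL hs subrr.
have zi i : L (s i) = f b' (s i).
  have /eqP := z; rewrite psumr_eq0; last first.
    by move=> j _; rewrite subr_ge0 (le_trans (fb _)).
  by move=> /allP /(_ i (mem_index_enum _)) /=; rewrite subr_eq0 => /eqP.
have fi i : f b (s i) = L (s i) by apply: le_anti; rewrite fL zi fb.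
split; last first.
  move=> i; have /eqP := fi i; rewrite /f /L (chord_le (s i) m b0).2.
  by move=> /orP[/eqP|/eqP]; auto.
(* An empty part contributes 0 whatever [b] is; a nonempty one is needed to read off [b' = b]. *)
have [i si] : exists i, (0 < s i)%N.
  apply/existsP; rewrite -[X in is_true X]negbK negb_exists; apply/negP => /forallP h.
  have /eqP := hs; rewrite big1 ?(eq_sym 0) ?oner_eq0 // => i _.
  by have := h i; rewrite lt0n negbK => /eqP ->; rewrite mul0r.
have := zi i; rewrite -fi /f => /mulfI; rewrite pnatr_eq0 -lt0n => /(_ si) /invr_inj.
by move=> /addIr.
Qed.

Lemma turan_part n (i : 'I_k) :
  #|[set u : 'I_n | (u %% k)%N == i]| = (n %/ k + (i < n %% k))%N.
Proof.
have k0 : (0 < k)%N by case: i => ?; case: k.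
have -> : #|[set u : 'I_n | (u %% k)%N == i]| = (\sum_(u < n) ((u %% k)%N == i :> nat))%N.
  by rewrite -sum1_card big_mkcond /=; apply: eq_bigr => u _; rewrite inE; case: eqP.
elim: n => [|n IH]; first by rewrite big_ord0 div0n mod0n.
rewrite big_ord_recr /= IH -addnA.
have nk := ltn_pmod n k0; rewrite [in RHS](divn_eq n k) -addnS.
move: (n %/ k)%N (n %% k)%N nk => c r; rewrite leq_eqVlt => /orP[/eqP rk|rk].
  rewrite rk -mulSnr mulnK // modnMl ltn0 addn0 -[c.+1]addn1; congr (_ + _)%N.
  have := ltn_ord i; rewrite -{2}rk ltnS leq_eqVlt eq_sym.
  by case: ltngtP.
rewrite divnMDl // divn_small // addn0 modnMDl modn_small // ltnS; congr (_ + _)%N.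
by case: ltngtP.
Qed.

End Balanced.

(** * The Turan graph *)

Section Turan.
Variables (n k : nat).
Hypothesis k_gt0 : (0 < k)%N.

Definition turan_class (u : 'I_n) : 'I_k := Ordinal (ltn_pmod u k_gt0).

Lemma turan_adjE u v : adj (turan_graph n k) u v = (turan_class u != turan_class v).
Proof. by []. Qed.

Lemma card_turan_class i :
  #|part turan_class i| = (n %/ k)%N \/ #|part turan_class i| = (n %/ k).+1%N.
Proof.
have -> : part turan_class i = [set u : 'I_n | (u %% k)%N == i].
  by apply/setP => u; rewrite !inE.
by rewrite turan_part; case: (_ < _)%N; [right; rewrite addn1|left; rewrite addn0].
Qed.

(** Rayleigh quotient of the all-ones vector, with every degree at least [n - n/k - 1]. *)
Lemma turan_index_ge (R : realType) (q : R) : (0 < n)%N ->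
  largest_eigenvalue (signless_laplacian R (turan_graph n k)) q ->
  2 * (n%:R - n%:R / k%:R - 1) <= q.
Proof.
move=> n0 hq; have Np : 0 < n%:R :> R by rewrite ltr0n.
have kp : 0 < k%:R :> R by rewrite ltr0n.
have := energy_le (fun=> 1) n0 hq.
have -> : \sum_(u < n) 1 ^+ 2 = n%:R :> R.
  by rewrite expr1n sumr_const card_ord.
have : n%:R * (4 * (n%:R - n%:R / k%:R - 1)) <=
    energy (adj (turan_graph n k)) (fun=> 1 : R).
  have -> : n%:R * (4 * (n%:R - n%:R / k%:R - 1)) =
      \sum_(u < n) 4 * (n%:R - n%:R / k%:R - 1) :> R.
    by rewrite sumr_const card_ord mulr_natl.
  apply: ler_sum => u _; rewrite -mulr_suml -degE mulrC.
  have -> : (1 + 1) ^+ 2 = 4 :> R by ring.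
  rewrite ler_pM2r // /deg -/(nbr _ u) (multipartite_nbr turan_adjE).
  have := cardr_C R (part turan_class (turan_class u)).
  have : #|part turan_class (turan_class u)|%:R <= n%:R / k%:R + 1 :> R.
    apply: (@le_trans _ _ (n %/ k).+1%:R).
      by rewrite ler_nat; case: (card_turan_class (turan_class u)) => ->.
    by rewrite -natr1 lerD2r ler_pdivlMr // -natrM ler_nat leq_divM.
  lra.
move=> h1 h2; have := le_trans h1 h2.
rewrite [2 * (q * _)]mulrA mulrC ler_pM2r //; lra.
Qed.

End Turan.

(** * Assembling the comparison with the Turán graph *)

Section MultipartiteGraph.
Variables (n k : nat) (P : 'I_n -> 'I_k).
Definition part_adj : rel 'I_n := fun u v => P u != P v.
Lemma part_sym : symmetric part_adj.
Proof. by move=> u v; rewrite /part_adj eq_sym. Qed.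
Lemma part_irr : irreflexive part_adj.
Proof. by move=> u; rewrite /part_adj eqxx. Qed.
Definition multipartite_graph : graph n := Graph part_sym part_irr.
End MultipartiteGraph.

(** The choice of [ep] gives [1000 K^2 a = M] for [a = ep n], and [18 g = ep^2] turns the weight
    deficit into [ep a]. The condition [2 <= g^2 n] absorbs the additive error 2 of
    [turan_index_ge]. *)
Lemma turan_of_bookfree (R : realType) (n k : nat) (G : graph n) (g ep qG qT : R) :
  (3 <= k)%N -> (0 < n)%N ->
  ep = 1 / (1000 * k%:R ^+ 3) -> g = ep ^+ 2 / 18 -> 2 <= g ^+ 2 * n%:R ->
  largest_eigenvalue (signless_laplacian R G) qG ->
  largest_eigenvalue (signless_laplacian R (turan_graph n k)) qT ->
  qT <= qG -> bookfree G k (g ^+ 2 * n%:R) -> isomorphic G (turan_graph n k).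
Proof.
move=> k3 n0 eE gE gN hG hT qTG Gk.
have k0 : (0 < k)%N := ltnW (ltnW k3).
have K3 : 3 <= k%:R :> R by rewrite ler_nat.
have kp : 0 < k%:R :> R by lra.
have ep0 : 0 < ep by rewrite eE divr_gt0 // mulr_gt0 // exprn_gt0.
have epK : 1000 * (k%:R ^+ 2 * ep) = 1 / k%:R by rewrite eE; field; rewrite gt_eqF.
have kV0 : 0 < 1 / k%:R :> R by rewrite divr_gt0.
have kV1 : 1 / k%:R <= 1 / 3 :> R by rewrite !mul1r lef_pV2 ?posrE.
have ep1 : ep <= 1/1000.
  have : 1 <= k%:R ^+ 2 :> R by rewrite exprn_ege1 //; lra.
  rewrite -(ler_pM2r ep0) => h; lra.
clear eE.
have ep2 : ep ^+ 2 <= ep / 1000 by rewrite expr2 ler_wpM2l; lra.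
have ep20 : 0 < ep ^+ 2 by rewrite exprn_gt0.
have g0 : 0 < g by lra.
have g1 : g <= 1/18 by lra.
have g2 : g ^+ 2 <= g / 18 by rewrite expr2 ler_wpM2l; lra.
have Np : 0 < n%:R :> R by rewrite ltr0n.
pose N : R := n%:R; pose M := N / k%:R; pose a := ep * N.
have ma : g ^+ 2 * N <= a by rewrite ler_pM2r //; lra.
have NM : N = k%:R * M by rewrite /M mulrC divfK // gt_eqF.
have Ma : 1000 * (k%:R ^+ 2 * a) <= M.
  have -> : 1000 * (k%:R ^+ 2 * a) = 1000 * (k%:R ^+ 2 * ep) * N by rewrite /a; ring.
  by rewrite epK /M mul1r mulrC.
clear epK.
have M3 : M <= N / 3 by rewrite ler_pM2l //; move: kV1; rewrite !mul1r.
clear kV0 kV1.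
have qT0 := turan_index_ge k0 n0 hT; rewrite -/N -/M in qT0.
have a2 : 2 <= a by apply: le_trans gN ma.
clear ep2 g2.
have aN : a <= N / 1000 by rewrite /a mulrC ler_pM2l //; lra.
have qTN : N < qT by lra.
have [y [u0 [hy y01 yu0]]] := perron_eigenfun n0 hG.
have S1 : (1 - 18 * g) * N <= \sum_u y u.
  apply: (total_weight (e := 2) (m := g ^+ 2 * N) n0 k3 hy y01 yu0 _ _ _ Gk).
  - by rewrite g0.
  - by rewrite ler0n.
  - by rewrite lexx mulr_ge0 // ?ltW // exprn_gt0.
  - apply: le_trans qTG; apply: le_trans qT0.
    by rewrite le_eqVlt; apply/orP; left; apply/eqP; rewrite /M -/N; ring.
have yS : \sum_u (1 - y u) <= ep * a.
  rewrite sumrB sumr_const card_ord -/N /a mulrA -expr2.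
  by move: S1; rewrite gE mulrBl mul1r; lra.
clear S1 gE.
pose H : {set 'I_n} := [set u | 1 - ep <= y u].
(* Markov: each vertex outside [H] contributes more than [ep] to a total deficit of at most
   [ep a]. *)
have H_co : #|~: H|%:R <= a.
  rewrite -(ler_pM2l ep0); apply: le_trans yS.
  rewrite cardr_sum mulr_sumr; apply: ler_sum => u _.
  have /andP[_ y1] := y01 u; rewrite !inE -ltNge.
  by case: (ltP (y u) (1 - ep)) => h /=; lra.
clear gN g1 ep20.
have H_deg u : u \in H -> N - M - 2 * a <= (deg G u)%:R.
  rewrite inE => yu; have /andP[y0 y1] := y01 u.
  (* The eigenvalue equation at an entry close to 1 reads [q (1 - ep) <= 2 deg u], and [q] is at
     least [2 (N - M - 1)]. *)
  have h1 : (qG - (deg G u)%:R) * y u <= (deg G u)%:R.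
    by rewrite hy; exact: setweight_le_card.
  have h2 : qG * (1 - ep) <= qG * y u by rewrite ler_wpM2l //; lra.
  have h3 : (deg G u)%:R * y u <= (deg G u)%:R * 1 by rewrite ler_wpM2l.
  have h4 : 2 * (N - M - 1) * (1 - ep) <= qG * (1 - ep).
    by rewrite ler_wpM2r //; lra.
  have h5 : ep * (N - M - 1) <= ep * N by rewrite ler_pM2l //; have := divr_ge0 (ltW Np) (ltW kp); rewrite -/N -/M; lra.
  by rewrite /a in a2 *; lra.
have m_bd : 0 < g ^+ 2 * N <= a by rewrite ma mulr_gt0 // exprn_gt0.
have [C hC] := core_exists k3 NM m_bd Ma Gk H_co H_deg.
have /fin_all_exists[P hP] : forall w, exists i,
    #|C i :&: nbr G w|%:R <= 7 * (k%:R ^+ 2 * a).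
  by move=> w; exact: (core_sparse k3 m_bd Ma Gk w hC).
have yH u : u \in H -> 1/2 <= y u by rewrite inE; lra.
have yS' : \sum_u (1 - y u) <= a.
  by apply: le_trans yS _; rewrite -[leRHS]mul1r ler_wpM2r //; lra.
have [E1 E2] := energy_compare k3 NM m_bd Ma Gk hC hP hy y01 yH yS'.
have [qK hK] := largest_eigenvalue_exists R (multipartite_graph P) n0.
have E3 := energy_le y n0 hK; rewrite /= in E3.
have E4 := energy_eigenfun hy.
have sq : 0 < \sum_u y u ^+ 2.
  by rewrite (bigD1 u0) //= yu0 expr1n ltr_pwDl // sumr_ge0 // => u _; rewrite sqr_ge0.
have qGK : qG <= qK.
  by rewrite -(ler_pM2r sq) -(@ler_pM2l _ 2) // -E4; exact: le_trans E1 E3.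
have [zK hzK zK0] := largest_eigenvalue_eigenfun hK.
have [zT hzT zT0] := largest_eigenvalue_eigenfun hT.
have sK : \sum_i #|part P i|%:R / (qK - N + 2 * #|part P i|%:R) = 1.
  apply: multipartite_eigen hzK zK0 => //.
  by apply: lt_le_trans qTN _; exact: le_trans qGK.
have sT := multipartite_eigen (@turan_adjE n k k0) qTN hzT zT0.
have [||qKT bal] := balanced_of_sums _ _ (@card_turan_class n k k0) sK sT.
- by rewrite subr_gt0 qTN lerD2r (le_trans qTG).
- by rewrite !sum_card_part.
have {}qKT : qK = qT by apply: (addIr (- N)).
(* Now [qK = qT <= qG], so the energy of the multipartite graph at [y] cannot exceed that of [G]:
   this is the equality case. *)
have adjE : forall u v, adj G u v = (P u != P v).
  apply: E2; rewrite E4; apply: le_trans E3 _.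
  by rewrite ler_pM2l // ler_pM2r // qKT.
exact: (balanced_iso adjE).
Qed.

Theorem theorem2p11 (R : realType) (k : nat) :
  (3 <= k)%N ->
  exists c : R, 0 < c /\
  exists n0 : nat, forall n : nat, (n0 <= n)%N ->
  forall (G : graph n) (qG qT : R),
    largest_eigenvalue (signless_laplacian R G) qG ->
    largest_eigenvalue (signless_laplacian R (turan_graph n k)) qT ->
    qT <= qG ->
    ~ isomorphic G (turan_graph n k) ->
    exists t : nat, c * n%:R <= t%:R /\ contains_copy (book_graph k t) G.
Proof.
move=> k3; pose ep : R := 1 / (1000 * k%:R ^+ 3); pose g := ep ^+ 2 / 18.
have k0 : 0 < k%:R :> R by rewrite ltr0n (ltnW (ltnW k3)).
have g0 : 0 < g ^+ 2.
  by rewrite exprn_gt0 // divr_gt0 // exprn_gt0 // divr_gt0 // mulr_gt0 // exprn_gt0.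
(* The threshold ensures [2 <= g^2 n]; the successor also gives [0 < n]. *)
exists (g ^+ 2); split=> //; exists (Num.bound (2 / g ^+ 2)).+1 => n nb G qG qT hG hT qTG Giso.
have gN : 2 <= g ^+ 2 * n%:R.
  rewrite mulrC -ler_pdivrMr // ltW //; apply: lt_le_trans (_ : (Num.bound (2 / g ^+ 2))%:R <= _).
    by apply: archi_boundP; rewrite divr_ge0 // ltW.
  by rewrite ler_nat ltnW.
apply: boolp.contrapT => nobook; apply: Giso.
apply: (turan_of_bookfree k3 _ _ _ gN hG hT qTG) => //.
- exact: leq_trans nb.
- exact: bookfree_of_no_book.
Qed.
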